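(* Let $h>0$, $0<\alpha<1$ and $1\leq p\leq\infty$. (i) Let $u\in\ell^p(\mathbb{Z}_h)$ be such that $u(j_0h)=0$ for some $j_0\in\mathbb{Z}$, and $u(jh)\geq 0$ for all integers $j\geq j_0$. Then $(\delta_{\rm right})^{\alpha}u(j_0h)\leq 0$. Moreover, $(\delta_{\rm right})^{\alpha}u(j_0h)=0$ if and only if $u(jh)=0$ for all integers $j\geq j_0$. (ii) Let $u,v\in\ell^p(\mathbb{Z}_h)$ be such that $u(j_0h)=v(j_0h)$ for some $j_0\in\mathbb{Z}$, and $u(jh)\geq v(jh)$ for all integers $j\geq j_0$. Then $(\delta_{\rm right})^{\alpha}u(j_0h)\leq(\delta_{\rm right})^{\alpha}v(j_0h)$. Moreover, $(\delta_{\rm right})^{\alpha}u(j_0h)=(\delta_{\rm right})^{\alpha}v(j_0h)$ if and only if $u(jh)=v(jh)$ for all integers $j\geq j_0$.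
   Context: For $h>0$, $\mathbb{Z}_h=\{jh: j\in\mathbb{Z}\}$, and $\ell^p(\mathbb{Z}_h)$ is the space of functions $u:\mathbb{Z}_h\to\mathbb{R}$ that are $p$-summable (bounded if $p=\infty$). The discrete derivative from the right is $\delta_{\rm right}u(nh)=\frac{u(nh)-u((n+1)h)}{h}$. For $0<\alpha<1$ its fractional power is $$(\delta_{\rm right})^{\alpha}u(nh)=\frac{1}{\Gamma(-\alpha)}\int_0^\infty\Big(\sum_{j=0}^\infty e^{-t/h}\frac{(t/h)^j}{j!}u((n+j)h)-u(nh)\Big)\frac{dt}{t^{1+\alpha}},$$ equivalently $$(\delta_{\rm right})^{\alpha}u(nh)=\frac{1}{h^{\alpha}}\sum_{j=0}^{\infty}\Lambda^\alpha(j)\,\big(u((n+j)h)-u(nh)\big)=\frac{1}{h^{\alpha}}\sum_{j=0}^{\infty}\Lambda^\alpha(j)\,u((n+j)h),$$ where $\Lambda^\alpha(m)=\binom{-\alpha-1+m}{m}=(-1)^m\binom{\alpha}{m}$, $m\in\mathbb{N}_0$. *)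

(* Defs.v *)
From mathcomp Require Import all_boot all_order all_algebra.
From mathcomp Require Import all_classical all_reals all_analysis.

Set Implicit Arguments.
Unset Strict Implicit.
Unset Printing Implicit Defensive.

Import Order.TTheory GRing.Theory Num.Theory.
Import numFieldNormedType.Exports.

Local Open Scope classical_set_scope.
Local Open Scope ring_scope.

Definition grid (R : realType) (h : R) : set R :=
  range (fun j : int => j%:~R * h).

Lemma node_subproof (R : realType) (h : R) (j : int) :
  j%:~R * h \in grid h.
Proof. by apply/mem_set; exists j. Qed.

(* The point j h of the grid, so that the value u(j h) is [u (node h j)]. *)
Definition node (R : realType) (h : R) (j : int) : grid h :=
  SigSub (node_subproof h j).

(* Only exponents in [1, +oo] are meaningful. *)
Definition lp (R : realType) (h : R) (p : \bar R) (u : grid h -> R) : Prop :=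
  match p with
  | r%:E => summable [set: grid h] (fun x => (`|u x| `^ r)%:E)
  | +oo%E => exists M : R, forall x, `|u x| <= M
  | -oo%E => False
  end.

Definition euler_integral (R : realType) (s : R) : R :=
  \int[lebesgue_measure]_(t in `]0, +oo[) (t `^ (s - 1) * expR (- t)).

(* The Gamma function on the real line minus {0, -1, -2, ...}: the extension of
   the Euler integral through Gamma (s + 1) = s * Gamma s.  The number n of
   steps is the least one such that s + n > 0 (n = 0 when s > 0).  At the
   poles the value is 0, by division by zero. *)
Definition Gamma (R : realType) (s : R) : R :=
  let n := Num.truncn (1 - s) in
  euler_integral (s + n%:R) / \prod_(k < n) (s + k%:R).

(* The semigroup generated by - delta_right, where
   delta_right u (n h) = (u (n h) - u ((n + 1) h)) / h. *)
Definition semigroup (R : realType) (h t : R) (u : grid h -> R) (n : int) : R :=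
  limn (series (fun j : nat =>
    expR (- (t / h)) * ((t / h) ^+ j / j`!%:R) * u (node h (n + j%:Z)))).

(* (delta_right)^alpha u (n h), for 0 < alpha < 1. *)
Definition frac_delta_right (R : realType) (h alpha : R) (u : grid h -> R)
    (n : int) : R :=
  (Gamma (- alpha))^-1 *
  \int[lebesgue_measure]_(t in `]0, +oo[)
    ((semigroup t u n - u (node h n)) / t `^ (1 + alpha)).

(* Main.v *)
(* The semigroup averages the values of u to the right of n against the Poisson
   weights e^(-s) s^j / j! with s = t / h.  These weights sum to 1, so for u
   bounded the deviation from u(n) is O(1 - e^(-s)), hence O(min(t, 1)), and the
   integral defining the fractional derivative converges absolutely; this makes
   the operator linear and reduces the comparison of u and v to u - v >= 0.  If
   u(j0) = 0 and u >= 0 to the right of j0, the integrand is nonnegative, and it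
   is positive for every t > 0 as soon as some u(j0 + k) is positive.  The sign
   of the conclusion comes from Gamma (- alpha) < 0. *)

Require Import Defs.
From mathcomp Require Import all_boot all_order all_algebra.
From mathcomp Require Import all_classical all_reals all_analysis.
From mathcomp Require Import measurable_realfun lra.

Import Order.TTheory GRing.Theory Num.Theory.
Import numFieldNormedType.Exports.

Local Open Scope classical_set_scope.
Local Open Scope ring_scope.

(** * Integrability on the half-line by comparison with powers of t *)

Section Integrability.
Context {R : realType}.
Notation mu := (@lebesgue_measure R).

(** If the integral were zero, [f] would vanish almost everywhere on [D]; since it vanishes nowhere
    there, [D] would sit inside a null set. *)
Lemma Rintegral_gt0 (D : set R) (f : R -> R) :
  measurable D -> (0 < mu D)%E -> mu.-integrable D (EFin \o f) ->
  (forall x, D x -> 0 < f x) -> 0 < \int[mu]_(x in D) f x.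
Proof.
move=> mD D0 fi f0; rewrite lt0r Rintegral_ge0 ?andbT; last by move=> x /f0/ltW.
(* The real-valued integral is [fine] of the extended one, and [fine] also sends infinite values to
   0; integrability rules that case out. *)
apply/eqP => If0; have If : (\int[mu]_(x in D) `|(EFin \o f) x| = 0)%E.
  rewrite -[RHS]/((0 : R)%:E) -If0 fineK; last exact: integrable_fin_num.
  by apply: eq_integral => x /set_mem Dx; rewrite /= ger0_norm// ltW// f0.
have/(ae_eq_integral_abs mu mD (measurable_int _ fi)) [N [mN N0 sub]] := If.
suff DN : D `<=` N.
  have : (mu D <= mu N)%E by apply: le_measure; rewrite ?inE.
  by rewrite N0 leNgt D0.
by move=> x Dx; apply: sub => /= /(_ Dx) [] /eqP; rewrite gt_eqF// f0.
Qed.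

Lemma continuous_powR (s x : R) :
  0 < x -> {for x, continuous (fun t : R => t `^ s)}.
Proof.
move=> x0; apply: differentiable_continuous; apply/derivable1_diffP.
by apply: derivable_powR; rewrite in_itv/= x0.
Qed.

Lemma integral_powR_itvcc (s a b : R) : 0 < a -> a < b -> s + 1 != 0 ->
  (\int[mu]_(t in `[a, b]) (t `^ s)%:E =
   ((b `^ (s + 1) - a `^ (s + 1)) / (s + 1))%:E)%E.
Proof.
move=> a0 ab s0.
have gt0 (x : R) : x \in `[a, b] -> 0 < x.
  by rewrite in_itv/= => /andP[/(lt_le_trans a0)].
pose F t := t `^ (s + 1) / (s + 1).
have dF (x : R) : 0 < x -> is_derive x 1 F (x `^ s).
  move=> x0; have h := is_derive1_powR (s + 1) x0.
  apply: is_derive_eq; rewrite !scaler0 add0r addrK /GRing.scale/=.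
  by rewrite mulrA mulVf// mul1r.
rewrite (@continuous_FTC2 _ _ F)//.
- by rewrite -EFinB mulrBl.
- apply: continuous_in_subspaceT => x /set_mem/= /gt0; exact: continuous_powR.
- have cF (x : R) : x \in `[a, b] -> {for x, continuous F}.
    move=> /gt0 x0; apply: cvgM; last exact: cvg_cst. exact: continuous_powR.
  split.
  + by move=> x /subset_itv_oo_cc /gt0 /dF; case.
  + by apply: cvg_at_right_filter; apply: cF; rewrite in_itv/= lexx ltW.
  + by apply: cvg_at_left_filter; apply: cF; rewrite in_itv/= lexx ltW.
- by move=> x /subset_itv_oo_cc /gt0 /dF; rewrite derive1E => -[].
Qed.

(** Monotone convergence along an exhaustion: it reduces improper integrals of powers to compact
    intervals, where an antiderivative gives the value. *)
Lemma integrable_bigcup_bounded (F : (set R)^nat) (f : R -> R) (M : R) :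
  nondecreasing_seq F -> (forall n, measurable (F n)) ->
  measurable_fun setT f -> (forall x, 0 <= f x) ->
  (forall n, \int[mu]_(x in F n) (f x)%:E <= M%:E)%E ->
  mu.-integrable (\bigcup_n F n) (EFin \o f).
Proof.
move=> nF mF mf f0 fM.
have mU : measurable (\bigcup_n F n) by exact: bigcup_measurable.
apply/integrableP; split.
  by apply/measurable_EFinP; exact: measurable_funS mf.
apply: (@le_lt_trans _ _ M%:E); last exact: ltry.
under eq_integral do rewrite /= ger0_norm//.
have cv : (\int[mu]_(x in F n) (f x)%:E @[n --> \oo] -->
    \int[mu]_(x in \bigcup_n F n) (f x)%:E)%E.
  apply: ge0_nondecreasing_set_cvg_integral => // [n|n x _].
    2: by rewrite lee_fin.
  by apply/measurable_EFinP; exact: measurable_funS mf.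
rewrite -(cvg_lim _ cv)//; apply: lime_le.
  by apply/cvg_ex; eexists; exact: cv.
exact: nearW.
Qed.

Lemma integrable_powR_near0 (s : R) : -1 < s ->
  mu.-integrable `]0, 1] (EFin \o (@powR R ^~ s)).
Proof.
move=> s1; have s0 : 0 < s + 1 by lra.
(* The denominators start at 2, so that every interval of the exhaustion is nondegenerate. *)
have -> : `]0, 1]%classic = \bigcup_n `[n.+2%:R^-1, (1 : R)]%classic.
  apply/seteqP; split => x /=; rewrite in_itv/=.
    move=> /andP[x0 x1]; have [n] := ltr_add_invr x0.
    rewrite add0r => nx; exists n => //=; rewrite in_itv/= x1 andbT.
    by apply/ltW/(le_lt_trans _ nx); rewrite lef_pV2 ?posrE// ler_nat.
  by move=> [n _ /=]; rewrite in_itv/= => /andP[/(lt_le_trans _)->].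
apply: (@integrable_bigcup_bounded _ _ (s + 1)^-1).
- apply/nondecreasing_seqP => n; rewrite subsetEset; apply: subset_itvr.
  by rewrite bnd_simp lef_pV2 ?posrE// ler_nat.
- by move=> n; exact: measurable_itv.
- exact: measurable_powR.
- by move=> x; exact: powR_ge0.
- move=> n; rewrite integral_powR_itvcc// ?lt0r_neq0 ?invf_lt1 ?ltr1n//.
  by rewrite lee_fin powR1 ler_pdivrMr// mulVf ?lt0r_neq0// gerBl powR_ge0.
Qed.

Lemma integrable_powR_nearoo (s : R) : s < -1 ->
  mu.-integrable `]1, +oo[ (EFin \o (@powR R ^~ s)).
Proof.
move=> s1; have s0 : s + 1 < 0 by lra.
have I : mu.-integrable (\bigcup_n `[(1 : R), n.+2%:R]%classic)
    (EFin \o (@powR R ^~ s)).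
  (* The integral over [1, b] is (1 - b^(s+1)) / (-(s+1)), and the subtracted power is
     nonnegative. *)
  apply: (@integrable_bigcup_bounded _ _ (- (s + 1))^-1).
  - apply/nondecreasing_seqP => n; rewrite subsetEset; apply: subset_itvl.
    by rewrite bnd_simp ler_nat.
  - by move=> n; exact: measurable_itv.
  - exact: measurable_powR.
  - by move=> x; exact: powR_ge0.
  - move=> n; rewrite integral_powR_itvcc// ?ltr0_neq0 ?ltr1n//.
    rewrite lee_fin powR1 -opprB mulNr -mulrN -invrN.
    rewrite ler_pdivrMr ?oppr_gt0// mulVf ?gt_eqF ?oppr_gt0// ?gerBl ?powR_ge0.
apply: integrableS I => //.
- by apply: bigcup_measurable => n _; exact: measurable_itv.
- move=> x /=; rewrite in_itv/= andbT => x1; exists (Num.truncn x) => //=.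
  rewrite in_itv/= (ltW x1)/=; apply/ltW/(lt_trans (truncnS_gt _)).
  by rewrite ltr_nat.
Qed.

(** Split at 1: the bound with exponent [r] serves near 0, the one with exponent [s] near infinity.
    Both the fractional-derivative integrand and the Euler integrand are treated this way. *)
Lemma integrable_le_powR (f : R -> R) (A B r s : R) :
  -1 < r -> s < -1 -> measurable_fun `](0 : R), +oo[ f ->
  (forall t, 0 < t -> `|f t| <= A * t `^ r) ->
  (forall t, 0 < t -> `|f t| <= B * t `^ s) ->
  mu.-integrable `]0, +oo[ (EFin \o f).
Proof.
move=> r1 s1 mf fA fB.
have U : `](0 : R), +oo[%classic = `]0, 1] `|` `]1, +oo[.
  by rewrite -itv_bndbnd_setU// bnd_simp.
have I1 : mu.-integrable `]0, 1] (EFin \o f).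
  have I := integrable_powR_near0 _ r1.
  have := fun mD => integrableZl mD A I; move=> /(_ (measurable_itv _)).
  apply: le_integrable => //.
  - apply/measurable_EFinP; apply: measurable_funS mf => //.
    by rewrite U; exact: subsetUl.
  - move=> t /=; rewrite in_itv/= => /andP[t0 _]; rewrite lee_fin.
    by apply: le_trans (fA _ t0) _; exact: ler_norm.
have I2 : mu.-integrable `]1, +oo[ (EFin \o f).
  have I := integrable_powR_nearoo _ s1.
  have := fun mD => integrableZl mD B I; move=> /(_ (measurable_itv _)).
  apply: le_integrable => //.
  - apply/measurable_EFinP; apply: measurable_funS mf => //.
    by rewrite U; exact: subsetUr.
  - move=> t /=; rewrite in_itv/= andbT => t1; rewrite lee_fin.
    by apply: le_trans (fB _ (lt_trans ltr01 t1)) _; exact: ler_norm.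
move/integrableP: I1 => [_ I1]; move/integrableP: I2 => [_ I2].
apply/integrableP; split; first exact/measurable_EFinP.
rewrite U ge0_integral_setU//=.
- exact: lte_add_pinfty.
- by rewrite -U; apply/measurable_EFinP; exact: measurableT_comp.
- apply/disj_setPS => x /= []; rewrite !in_itv/= => /andP[_ x1].
  by rewrite ltNge x1.
Qed.

End Integrability.

(** * Averages of bounded sequences against Poisson weights *)

Section PoissonMean.
Context {R : realType}.
Implicit Types (a b : nat -> R) (t c s C : R).

Definition poisson_weight t (j : nat) : R := expR (- t) * (t ^+ j / j`!%:R).

Definition poisson_terms a t (j : nat) : R := poisson_weight t j * a j.

(** When [a] lists the values of [u] from node n rightwards, [poisson_mean a (t / h)] is convertible
    to [semigroup t u n]. *)
Definition poisson_mean a t : R := limn (series (poisson_terms a t)).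

Lemma poisson_weight_ge0 t j : 0 <= t -> 0 <= poisson_weight t j.
Proof. by move=> t0; rewrite mulr_ge0 ?expR_ge0// divr_ge0// exprn_ge0. Qed.

Lemma poisson_weight_gt0 t j : 0 < t -> 0 < poisson_weight t j.
Proof.
by move=> t0; rewrite mulr_gt0 ?expR_gt0// divr_gt0 ?exprn_gt0.
Qed.

Lemma poisson_weight0 t : poisson_weight t 0 = expR (- t).
Proof. by rewrite /poisson_weight expr0 fact0 divr1 mulr1. Qed.

Lemma cvg_series_poisson_weight t : series (poisson_weight t) @ \oo --> (1 : R).
Proof.
have -> : series (poisson_weight t) = expR (- t) *: series (exp_coeff t).
  by rewrite -seriesZ.
rewrite -(expRxMexpNx_1 t) mulrC; apply: cvgZl_tmp.
exact: is_cvg_series_exp_coeff.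
Qed.

Lemma series_poisson_weight_le1 t n :
  0 <= t -> series (poisson_weight t) n <= 1.
Proof.
move=> t0; rewrite -(cvg_lim _ (cvg_series_poisson_weight t))//.
apply: nondecreasing_cvgn_le; last first.
  by apply/cvg_ex; eexists; exact: cvg_series_poisson_weight.
by apply: nondecreasing_series => k _ _; exact: poisson_weight_ge0.
Qed.

Lemma is_cvg_poisson_terms {a} C t : 0 <= t -> (forall j, `|a j| <= C) ->
  cvgn (series (poisson_terms a t)).
Proof.
move=> t0 aC; apply: normed_cvg.
apply: (@series_le_cvg _ _ (fun j => C * poisson_weight t j)) => [n|n|n|].
- exact: normr_ge0.
- by rewrite mulr_ge0 ?poisson_weight_ge0// (le_trans _ (aC n)).
- rewrite /= normrM ger0_norm ?poisson_weight_ge0// mulrC.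
  by rewrite ler_wpM2r ?poisson_weight_ge0.
- apply: (@is_cvg_seriesZ _ (poisson_weight t) C).
  by apply/cvg_ex; eexists; exact: cvg_series_poisson_weight.
Qed.

Lemma poisson_meanB a b C t : 0 <= t ->
  (forall j, `|a j| <= C) -> (forall j, `|b j| <= C) ->
  poisson_mean (fun j => a j - b j) t = poisson_mean a t - poisson_mean b t.
Proof.
move=> t0 aC bC; rewrite /poisson_mean -lim_seriesB; last 2 first.
- exact: is_cvg_poisson_terms aC.
- exact: is_cvg_poisson_terms bC.
congr (limn (series _)); apply/funext => j.
by rewrite /poisson_terms mulrBr.
Qed.

Lemma poisson_mean_cst C t : poisson_mean (cst C) t = C.
Proof.
rewrite /poisson_mean -[RHS]mulr1; apply/cvg_lim => //.
have -> : poisson_terms (cst C) t = C *: poisson_weight t.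
  by apply/funext => j; rewrite /poisson_terms mulrC.
by rewrite seriesZ; apply: cvgZl_tmp; exact: cvg_series_poisson_weight.
Qed.

(** The term j = 0 drops out because [a 0 = 0], and the remaining weights have total mass 1 -
    e^(-t). This factor later tames the singularity at t = 0. *)
Lemma norm_poisson_mean_le a C t : 0 <= t -> a 0 = 0 ->
  (forall j, `|a j| <= C) -> `|poisson_mean a t| <= C * (1 - expR (- t)).
Proof.
move=> t0 a0 aC; have C0 : 0 <= C by exact: le_trans (aC 0).
have cv := is_cvg_poisson_terms C t t0 aC.
rewrite -lim_norm//; apply: limr_le; first exact: is_cvg_norm.
(* The empty partial sum is treated apart; every other one contains the term j = 0, which can be
   split off. *)
apply: nearW => -[|n].
  rewrite /series/= big_geq// normr0 mulr_ge0// subr_ge0.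
  by rewrite expR_le1 oppr_le0.
apply: le_trans (_ : C * (series (poisson_weight t) n.+1 - expR (- t)) <= _).
  2: by rewrite ler_wpM2l// lerB// series_poisson_weight_le1.
rewrite /series/= !big_nat_recl// /poisson_terms a0 mulr0 add0r poisson_weight0.
rewrite [X in _ * X]addrAC subrr add0r mulr_sumr.
apply: le_trans (ler_norm_sum _ _ _) _; apply: ler_sum => j _.
rewrite normrM ger0_norm ?poisson_weight_ge0// mulrC.
by rewrite ler_wpM2r ?poisson_weight_ge0.
Qed.

Lemma poisson_mean_ge_term a C t k : 0 <= t -> (forall j, 0 <= a j) ->
  (forall j, `|a j| <= C) -> poisson_terms a t k <= poisson_mean a t.
Proof.
move=> t0 a0 aC; have cv := is_cvg_poisson_terms C t t0 aC.
have p0 j : 0 <= poisson_terms a t j by rewrite mulr_ge0 ?poisson_weight_ge0.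
apply: le_trans (nondecreasing_cvgn_le (nondecreasing_series _) cv k.+1) => //.
by rewrite big_nat_recr//= lerDr sumr_ge0.
Qed.

Lemma measurable_poisson_mean a C c : 0 < c -> (forall j, `|a j| <= C) ->
  measurable_fun `](0 : R), +oo[ (fun t => poisson_mean a (t / c)).
Proof.
move=> c0 aC.
apply: (@measurable_fun_cvg _ _ _ _
  (fun n t => series (poisson_terms a (t / c)) n)) => [n|t].
- rewrite /series/=; apply: measurable_sum => j.
  apply: measurable_funM => //; apply: measurable_funM.
    apply: measurableT_comp => //; apply: measurableT_comp => //.
    exact: measurable_funM.
  apply: measurable_funM => //; apply: measurable_funX; exact: measurable_funM.
- rewrite /= in_itv/= andbT => t0; apply: is_cvg_poisson_terms aC.
  by rewrite divr_ge0// ltW.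
Qed.

Lemma integrable_poisson_mean a C c s : 0 < c -> 0 < s -> s < 1 ->
  (forall j, `|a j| <= C) ->
  (@lebesgue_measure R).-integrable `](0 : R), +oo[
    (EFin \o fun t => (poisson_mean a (t / c) - a 0) / t `^ (1 + s)).
Proof.
move=> c0 s0 s1 aC.
(* Since the weights sum to 1, subtracting [a 0] amounts to averaging a j - a 0, a sequence that
   starts at 0 and is bounded by 2C. *)
have bnd (t : R) : 0 < t ->
    `|(poisson_mean a (t / c) - a 0) / t `^ (1 + s)| <=
    C *+ 2 * (1 - expR (- (t / c))) * t `^ (- (1 + s)).
  move=> t0; have tc : 0 <= t / c by rewrite divr_ge0// ltW.
  have C0 : `|a 0| <= C by [].
  rewrite powRN normrM [X in _ * X]ger0_norm ?invr_ge0 ?powR_ge0//.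
  rewrite ler_wpM2r ?invr_ge0 ?powR_ge0//.
  rewrite -[X in _ - X](poisson_mean_cst (a 0) (t / c)).
  rewrite -(@poisson_meanB _ _ C)//.
  apply: norm_poisson_mean_le => // [|j]; first by rewrite subrr.
  by rewrite mulr2n (le_trans (ler_normB _ _))// lerD.
have C0 : 0 <= C *+ 2 by rewrite mulrn_wge0// (le_trans _ (aC 0)).
(* Near 0, 1 - e^(-x) <= x yields the exponent -s > -1; near infinity, 1 - e^(-x) <= 1 yields -(1 +
   s) < -1. *)
apply: (@integrable_le_powR _ _ (C *+ 2 / c) (C *+ 2) (- s) (- (1 + s))).
- lra.
- lra.
- apply: measurable_funM.
    by apply: measurable_funB => //; exact: measurable_poisson_mean aC.
  apply: (eq_measurable_fun (fun t : R => t `^ (- (1 + s)))) => [x _|].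
    by rewrite powRN.
  by apply: measurable_funTS; exact: measurable_powR.
- move=> t t0; apply: le_trans (bnd t t0) _.
  have -> : t `^ (- s) = t * t `^ (- (1 + s)).
    rewrite -{2}(powRr1 (ltW t0)) -powRD; last by rewrite (gt_eqF t0) implybT.
    by congr (_ `^ _); lra.
  rewrite mulrA ler_wpM2r ?powR_ge0// -mulrA ler_wpM2l//.
  by have := expR_ge1Dx (- (t / c)); rewrite mulrC; lra.
- move=> t t0; apply: le_trans (bnd t t0) _.
  by rewrite ler_wpM2r ?powR_ge0// -[leRHS]mulr1 ler_wpM2l// gerBl expR_ge0.
Qed.

End PoissonMean.

(** * Sign of Gamma on (-1, 0), and boundedness of lp functions *)

Lemma euler_integral_gt0 (R : realType) (s : R) :
  0 < s -> s < 1 -> 0 < euler_integral s.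
Proof.
move=> s0 s1; apply: Rintegral_gt0 => //.
- by rewrite lebesgue_measure_itv/= ltry/= oppr0 adde0 ltry.
(* The two exponents come from e^(-t) <= 1 and from e^(-t) <= 1/t. *)
- apply: (@integrable_le_powR _ _ 1 1 (s - 1) (s - 2)).
  + lra.
  + lra.
  + apply: measurable_funM.
      by apply: measurable_funTS; exact: measurable_powR.
    by apply: measurableT_comp => //; exact: measurable_funTS.
  + move=> t t0; rewrite ger0_norm ?mulr_ge0 ?powR_ge0 ?expR_ge0// mul1r.
    by rewrite -[leRHS]mulr1 ler_wpM2l ?powR_ge0// expR_le1 oppr_le0 ltW.
  + move=> t t0; rewrite ger0_norm ?mulr_ge0 ?powR_ge0 ?expR_ge0// mul1r.
    have -> : t `^ (s - 2) = t `^ (s - 1) * t^-1.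
      rewrite -(powR_inv1 (ltW t0)) -powRD; last by rewrite (gt_eqF t0) implybT.
      by congr (_ `^ _); lra.
    rewrite ler_wpM2l ?powR_ge0// expRN lef_pV2 ?posrE ?expR_gt0//.
    by have := expR_ge1Dx t; lra.
- move=> t /=; rewrite in_itv/= andbT => t0.
  by rewrite mulr_gt0 ?powR_gt0 ?expR_gt0.
Qed.

(** One step of the recursion suffices: Gamma (-s) is the Euler integral at 1 - s, which is
    positive, divided by -s. *)
Lemma Gamma_opp_lt0 (R : realType) (s : R) : 0 < s -> s < 1 -> Gamma (- s) < 0.
Proof.
move=> s0 s1; have n1 : Num.truncn (1 - (- s)) = 1%N.
  by apply/truncn_def; lra.
rewrite /Gamma n1 big_ord1 addr0 pmulr_rlt0 ?invr_lt0 ?oppr_lt0//.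
by apply: euler_integral_gt0; lra.
Qed.

(** For finite exponent r >= 1, a value with |u x| > 1 satisfies |u x| <= |u x|^r, which is at most
    the whole sum; the maximum with 1 covers the other values. *)
Lemma lp_bounded {R : realType} {h : R} {p : \bar R} {u : grid h -> R} :
  (1%:E <= p)%E -> lp p u -> exists C : R, forall x, `|u x| <= C.
Proof.
case: p => [r||]//=; rewrite lee_fin => r1 su.
exists (Num.max 1
  (fine (\esum_(x in [set: grid h]) `|(`|u x| `^ r)%:E|)%E)) => x.
rewrite le_max; case: (leP `|u x| 1) => //= /ltW ux.
apply: le_trans (le1r_powR ux r1) _.
rewrite -lee_fin fineK; last by move: su; rewrite summableE.
apply: esum_ge; exists [set x]; first by split.
by rewrite fsbig_set1 /= lee_fin ler_norm.
Qed.

(** * Linearity and the maximum principle for bounded functions *)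

Section Comparison.
Context {R : realType} {h alpha : R}.
Hypotheses (h_gt0 : 0 < h) (alpha_gt0 : 0 < alpha) (alpha_lt1 : alpha < 1).
Implicit Types (u v : grid h -> R) (n : int) (C : R).

Definition forward_values u n (j : nat) : R := u (node h (n + j%:Z)).

Lemma forward_values0 u n : forward_values u n 0 = u (node h n).
Proof. by rewrite /forward_values addr0. Qed.

Lemma frac_delta_rightE u n : frac_delta_right alpha u n =
  (Gamma (- alpha))^-1 * \int[lebesgue_measure]_(t in `]0, +oo[)
    ((poisson_mean (forward_values u n) (t / h) - forward_values u n 0) /
     t `^ (1 + alpha)).
Proof. by rewrite forward_values0. Qed.

Lemma frac_delta_rightB {u v n C} :
  (forall x, `|u x| <= C) -> (forall x, `|v x| <= C) ->
  frac_delta_right alpha (fun x => u x - v x) n =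
  frac_delta_right alpha u n - frac_delta_right alpha v n.
Proof.
move=> uC vC; rewrite !frac_delta_rightE -mulrBr -RintegralB//; last 2 first.
- exact: integrable_poisson_mean (fun j => uC _).
- exact: integrable_poisson_mean (fun j => vC _).
congr (_ * _); apply: eq_Rintegral => t; rewrite inE/= in_itv/= andbT => t0.
rewrite -mulrBl; congr (_ / _).
rewrite (@poisson_meanB _ (forward_values u n) (forward_values v n) C).
- by rewrite opprD addrACA -opprD.
- by rewrite divr_ge0// ltW.
- by move=> j; exact: uC.
- by move=> j; exact: vC.
Qed.

(** Assuming a bound instead of membership in lp lets this apply directly to a difference u - v. *)
Lemma frac_delta_right_max_principle {u n C} :
  (forall x, `|u x| <= C) -> u (node h n) = 0 ->
  (forall j : int, n <= j -> 0 <= u (node h j)) ->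
  frac_delta_right alpha u n <= 0 /\
  (frac_delta_right alpha u n = 0 <->
   forall j : int, n <= j -> u (node h j) = 0).
Proof.
move=> uC un0 u0; rewrite frac_delta_rightE.
have G0 := Gamma_opp_lt0 _ alpha alpha_gt0 alpha_lt1.
set a := forward_values u n.
set f := fun t => (poisson_mean a (t / h) - a 0) / t `^ (1 + alpha).
have a00 : a 0 = 0 by rewrite /a forward_values0.
have a0 j : 0 <= a j by apply: u0; rewrite lerDl.
have aC j : `|a j| <= C by exact: uC.
have fi := integrable_poisson_mean a C h alpha h_gt0 alpha_gt0 alpha_lt1 aC.
(* A single term bounds [f] from below: k = 0 gives nonnegativity, and an index where [u] is
   positive gives strict positivity. *)
have f_ge k t : 0 < t -> poisson_terms a (t / h) k / t `^ (1 + alpha) <= f t.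
  move=> t0; rewrite /f a00 subr0 ler_wpM2r ?invr_ge0 ?powR_ge0//.
  by apply: poisson_mean_ge_term aC => //; rewrite divr_ge0// ltW.
have If0 : 0 <= \int[lebesgue_measure]_(t in `]0, +oo[) f t.
  apply: Rintegral_ge0 => t /=; rewrite in_itv/= andbT => t0.
  apply: le_trans (f_ge 0 t t0).
  by rewrite /poisson_terms a00 mulr0 mul0r.
split; first by rewrite nmulr_rle0 ?invr_lt0.
split=> [/eqP|un].
  rewrite mulf_eq0 invr_eq0 (lt_eqF G0)/= => /eqP I0 j nj.
  (* A nonzero u(j h) is positive, so the term k = j - n makes [f] positive on the whole half-line,
     contradicting the zero integral. *)
  apply/eqP/contraT => uj.
  suff : 0 < \int[lebesgue_measure]_(t in `]0, +oo[) f t by rewrite I0 ltxx.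
  apply: Rintegral_gt0 => //.
    by rewrite lebesgue_measure_itv/= ltry/= oppr0 adde0 ltry.
  move=> t /=; rewrite in_itv/= andbT => t0.
  have [k jE] : exists k : nat, j = n + k%:Z.
    by exists `|j - n|%N; rewrite gez0_abs ?subr_ge0// subrKC.
  apply: lt_le_trans (f_ge k t t0).
  rewrite divr_gt0 ?powR_gt0// mulr_gt0 ?poisson_weight_gt0 ?divr_gt0//.
  by rewrite lt0r a0 andbT /a /forward_values -jE.
have aE : a = cst 0 by apply/funext => j; apply: un; rewrite lerDl.
under eq_Rintegral do rewrite /f aE poisson_mean_cst subrr mul0r.
by rewrite Rintegral_cst// mul0r mulr0.
Qed.

End Comparison.

Theorem theorem1 (R : realType) (h alpha : R) (p : \bar R)
    (h_gt0 : 0 < h) (alpha_gt0 : 0 < alpha) (alpha_lt1 : alpha < 1)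
    (p_ge1 : (1%:E <= p)%E) :
  (forall (u : grid h -> R) (j0 : int),
     lp p u ->
     u (node h j0) = 0 ->
     (forall j : int, j0 <= j -> 0 <= u (node h j)) ->
     frac_delta_right alpha u j0 <= 0 /\
     (frac_delta_right alpha u j0 = 0 <->
      forall j : int, j0 <= j -> u (node h j) = 0)) /\
  (forall (u v : grid h -> R) (j0 : int),
     lp p u -> lp p v ->
     u (node h j0) = v (node h j0) ->
     (forall j : int, j0 <= j -> v (node h j) <= u (node h j)) ->
     frac_delta_right alpha u j0 <= frac_delta_right alpha v j0 /\
     (frac_delta_right alpha u j0 = frac_delta_right alpha v j0 <->
      forall j : int, j0 <= j -> u (node h j) = v (node h j))).
Proof.
split=> [u j0 /(lp_bounded p_ge1)[C uC] u0 uge|u v j0].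
  exact: (frac_delta_right_max_principle h_gt0 alpha_gt0 alpha_lt1 uC).
move=> /(lp_bounded p_ge1)[A uA] /(lp_bounded p_ge1)[B vB] uv uge.
(* Linearity is stated with one common bound, hence the maximum; its double bounds u - v. *)
have uC x : `|u x| <= Num.max A B by rewrite le_max uA.
have vC x : `|v x| <= Num.max A B by rewrite le_max vB orbT.
have wC x : `|u x - v x| <= Num.max A B *+ 2.
  by rewrite mulr2n (le_trans (ler_normB _ _))// lerD.
(* Part (ii) is the maximum principle for u - v, carried back through linearity. *)
have := frac_delta_right_max_principle h_gt0 alpha_gt0 alpha_lt1 wC (n := j0).
rewrite (frac_delta_rightB h_gt0 alpha_gt0 alpha_lt1 uC vC).
case=> [||le0 eq0]; first by rewrite uv subrr.
  by move=> j /uge; rewrite subr_ge0.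
split; first by rewrite -subr_le0.
split=> [/eqP|E].
  by rewrite -subr_eq0 => /eqP/eq0 H j /H /eqP; rewrite subr_eq0 => /eqP.
by apply/eqP; rewrite -subr_eq0; apply/eqP/eq0 => j /E ->; rewrite subrr.
Qed.
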